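(* Let $i, j, N$ be integers with $2 \leq i \leq j \leq N/2$. Then the greatest common divisor of the binomial coefficients $\binom{N}{i}$ and $\binom{N}{j}$ is at least $$\frac{(N-i+2)(N-i+1)}{i(i-1)}\left(\frac{2^{2i-3}(i-1)}{N^3}\right)^{1/2},$$ and hence is at least $$\frac{N^{1/2}\, 2^{i-7/2}}{i\,(i-1)^{1/2}}.$$ *)

(* Defs.v *)
From mathcomp Require Export all_boot all_order all_algebra.
From mathcomp Require Export reals exp.

(* Main.v *)
(** Let [g] be the gcd and [D := 'C(N, i) / g]. Splitting a set of size [N] into
    the four cells cut out by an [i]-subset and a [j]-subset gives
    ['C(N, j) * 'C(j, k) * 'C(N - j, i - k) = 'C(N, i) * 'C(i, k) * 'C(N - i, j - k)],
    so [D] divides ['C(j, k) * 'C(N - j, i - k)] for every [k]. With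
    [x := j - i + 1] and [b := N - j], the cases [k = i, i - 1] give
    [D <= 'C(j, i - 1) * gcd(x, b)], and [k = i - 1, i - 2] give
    [D <= 'C(j, i - 2) * b * gcd(x + 1, b - 1)]. These two gcds are coprime
    divisors of [N - i + 1], so multiplying the two bounds yields
    [D^2 <= 'C(j, i - 2)^2 * (x + 1) * b * (N - i + 1) / (i - 1)]; the theorem
    follows from [2^(i-2) * 'C(j, i - 2) <= 'C(N, i - 2)] and
    [4 * (x + 1) * b <= N^2]. *)

Require Import Defs.
From mathcomp Require Import all_boot all_order all_algebra.
From mathcomp Require Import reals exp.
From mathcomp Require Import zify ring lra.
Import Order.TTheory GRing.Theory Num.Theory.
Local Open Scope ring_scope.

Local Open Scope nat_scope.

Lemma bin_fact_add (m n : nat) : 'C(m + n, m) * (m`! * n`!) = (m + n)`!.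
Proof. by rewrite -[n in _ * n`!](addKn m n) bin_fact ?leq_addr. Qed.

(** Both sides are the multinomial coefficient of four cells of sizes [k], [p], [l], [q]: multiplied
    by the four factorials, each becomes the factorial of the total. *)
Lemma bin_mul_mul_bin (k p l q : nat) :
  'C(k + p + (l + q), k + p) * ('C(k + p, k) * 'C(l + q, l)) =
  'C(k + l + (p + q), k + l) * ('C(k + l, k) * 'C(p + q, p)).
Proof.
have := bin_fact_add (k + p) (l + q); have := bin_fact_add (k + l) (p + q).
rewrite addnACA -(bin_fact_add k p) -(bin_fact_add l q) -(bin_fact_add k l).
rewrite -(bin_fact_add p q) => <- E.
have f_gt0 : 0 < k`! * p`! * (l`! * q`!) by rewrite !muln_gt0 !fact_gt0.
apply/eqP; rewrite -(eqn_pmul2r f_gt0); apply/eqP.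
by move: E; lia.
Qed.

Lemma dvdn_bin_mul_bin (N i j k : nat) : k <= i -> k <= j -> i - k <= N - j -> j <= N ->
  'C(N, i) %| 'C(N, j) * ('C(j, k) * 'C(N - j, i - k)).
Proof.
move=> ki kj ikN jN; have := bin_mul_mul_bin k (j - k) (i - k) (N - j - (i - k)).
rewrite !subnKC // => ->.
by rewrite (_ : i + _ = N) ?dvdn_mulr //; lia.
Qed.

(** Gauss's lemma, once the common factor is cancelled from [a] and [b]. *)
Lemma dvdn_divn_gcdn (a b m : nat) : 0 < a -> a %| b * m -> a %/ gcdn a b %| m.
Proof.
move=> a_gt0 dvd_a_bm; have g_gt0 : 0 < gcdn a b by rewrite gcdn_gt0 a_gt0.
have co : coprime (a %/ gcdn a b) (b %/ gcdn a b).
  by rewrite /coprime -(eqn_pmul2r g_gt0) muln_gcdl !divnK ?dvdn_gcdl ?dvdn_gcdr // mul1n.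
rewrite -(Gauss_dvdr _ co) -(dvdn_pmul2r g_gt0) mulnAC.
by rewrite !divnK ?dvdn_gcdl ?dvdn_gcdr.
Qed.

(** Factor by factor: [2 * (a - t) <= N - t] for every [t]. *)
Lemma leq_exp2_bin (a N k : nat) : 2 * a <= N -> 2 ^ k * 'C(a, k) <= 'C(N, k).
Proof.
move=> aN; elim: k => [|k IHk]; first by rewrite !bin0.
rewrite -(leq_pmul2l (ltn0Sn k)) mul_bin_left expnS mulnCA mul_bin_left.
rewrite (_ : _ * _ = 2 * (a - k) * (2 ^ k * 'C(a, k))); last by lia.
by apply: leq_mul => //; lia.
Qed.

Lemma bin_add2 (n k : nat) :
  'C(n, k.+2) * (k.+2 * k.+1) = 'C(n, k) * ((n - k) * (n - k.+1)).
Proof. by have := mul_bin_left n k.+1; have := mul_bin_left n k; nia. Qed.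

(* The two gcds are coprime because they divide the consecutive numbers x and
   x.+1, and both divide x + b. *)
Lemma leq_mul_gcdn_succ (x b : nat) : 0 < x -> 0 < b ->
  gcdn x b * gcdn x.+1 b.-1 <= x + b.
Proof.
move=> x_gt0 b_gt0; apply: dvdn_leq; first by rewrite addn_gt0 x_gt0.
rewrite Gauss_dvd; last first.
  apply: (coprime_dvdl (dvdn_gcdl _ _)); apply: (coprime_dvdr (dvdn_gcdl _ _)).
  exact: coprimenS.
rewrite dvdn_add ?dvdn_gcdl ?dvdn_gcdr //= (_ : x + b = x.+1 + b.-1); last by lia.
by rewrite dvdn_add ?dvdn_gcdl ?dvdn_gcdr.
Qed.

Lemma leq_sqr_bin_divn_gcdn (N k j : nat) : k.+2 <= j -> 2 * j <= N ->
  ('C(N, k.+2) %/ gcdn 'C(N, k.+2) 'C(N, j)) ^ 2 * k.+1 <=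
  'C(j, k) ^ 2 * ((j - k) * (N - j) * (N - k.+1)).
Proof.
move=> kj jN; set D := _ %/ _.
have A_gt0 : 0 < 'C(N, k.+2) by rewrite bin_gt0; lia.
have D_dvd l : l <= k.+2 -> D %| 'C(j, l) * 'C(N - j, k.+2 - l).
  by move=> lk; apply: dvdn_divn_gcdn => //; apply: dvdn_bin_mul_bin; lia.
have jk : j - k = (j - k.+1).+1 by lia.
have b_gt0 : 0 < N - j by lia.
have x_gt0 : 0 < j - k.+1 by lia.
have k2 : k.+2 - k = 2 by lia.
have Nk : N - k.+1 = j - k.+1 + (N - j) by lia.
have [lekj ltkj] : k <= j /\ k < j by lia.
have := D_dvd k (leqW (leqnSn k)); have := D_dvd k.+1 (leqnSn _).
have := D_dvd _ (leqnn _).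
rewrite subnn bin0 muln1 subSnn bin1 k2 => D0 D1 D2.
have E1 := mul_bin_left j k; have E0 := mul_bin_left j k.+1.
rewrite jk in E1; rewrite {}jk {}Nk.
move: x_gt0 b_gt0 D0 D1 D2 E0 E1; move: (j - k.+1) (N - j) => x b.
move=> x_gt0 b_gt0 D0 D1 D2 E0 E1.
have Dd : D <= 'C(j, k.+1) * gcdn x b.
  apply: dvdn_leq; first by rewrite muln_gt0 bin_gt0 ltkj gcdn_gt0 x_gt0.
  (* By [E0], ['C(j, k.+1) * x] is a multiple of ['C(j, k.+2)], hence of [D]. *)
  by rewrite muln_gcdr dvdn_gcd D1 andbT mulnC -E0 dvdn_mull.
have De : D <= 'C(j, k) * b * gcdn x.+1 b.-1.
  apply: dvdn_leq; first by rewrite !muln_gt0 bin_gt0 lekj gcdn_gt0 b_gt0.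
  (* The two multiples of [D] are [k.+1 * 'C(j, k.+1) * b] and [2 * 'C(j, k) * 'C(b, 2)]. *)
  rewrite muln_gcdr dvdn_gcd; apply/andP; split.
    by rewrite mulnAC (mulnC 'C(j, k)) -E1 -mulnA dvdn_mull.
  have := mul_bin_left b 1; rewrite bin1 subn1 => Eb.
  by rewrite -mulnA (mulnC b) -Eb mulnCA dvdn_mull.
have de := leq_mul_gcdn_succ _ _ x_gt0 b_gt0.
apply: leq_trans (_ : 'C(j, k) ^ 2 * (x.+1 * b * (gcdn x b * gcdn x.+1 b.-1)) <= _).
  rewrite -mulnn -mulnA (leq_trans (leq_mul Dd (leq_mul De (leqnn _)))) //.
  rewrite [X in X <= _](_ : _ =
    k.+1 * 'C(j, k.+1) * ('C(j, k) * b * (gcdn x b * gcdn x.+1 b.-1))); last by ring.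
  by rewrite E1; apply/eq_leq; ring.
by rewrite !leq_mul2l de !orbT.
Qed.

(** The first bound for [i = k.+2], squared and cleared of denominators. *)
Lemma sqr_gcdn_bin_geq (N k j : nat) : k.+2 <= j -> 2 * j <= N ->
  2 ^ k.*2.+1 * k.+1 * ((N - k) * (N - k.+1)) ^ 2 <=
  gcdn 'C(N, k.+2) 'C(N, j) ^ 2 * (k.+2 * k.+1) ^ 2 * N ^ 3.
Proof.
move=> kj jN; have := leq_sqr_bin_divn_gcdn _ _ _ kj jN.
have gD := divnK (dvdn_gcdl 'C(N, k.+2) 'C(N, j)).
move: gD; set g := gcdn _ _; set D := _ %/ _ => gD leD.
have E := bin_add2 N k; rewrite -gD in E.
have leC := leq_exp2_bin _ _ k jN.
have C_gt0 : 0 < 'C(j, k) by rewrite bin_gt0; lia.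
(* AM-GM applies to [j - k] and [N - j], whose sum is [N - k]. *)
have lejb : 4 * ((j - k) * (N - j) * (N - k.+1)) <= N ^ 3.
  rewrite (expnSr _ 2) mulnA; apply: leq_mul; last by lia.
  by rewrite (leq_trans (nat_AGM2 _ _)) // leq_sqr; lia.
move: E leD leC lejb C_gt0; move: 'C(N, k) 'C(j, k) => M C E leD leC lejb C_gt0.
move: ((N - k) * (N - k.+1)) (k.+2 * k.+1) E => P I E.
rewrite -(leq_pmul2l (_ : 0 < C ^ 2)) ?expn_gt0 ?C_gt0 //.
(* The factor 4 is the one consumed by [lejb]; since [D * g * I = M * P], the left inequality has a
   factor 2 to spare. *)
apply: leq_trans (_ : 4 * (g ^ 2 * I ^ 2 * (D ^ 2 * k.+1)) <= _).
  rewrite (_ : 4 * _ = 4 * (k.+1 * (D * g * I) ^ 2)); last by lia.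
  rewrite E expnMn.
  have : (2 ^ k * C) ^ 2 <= M ^ 2 by rewrite leq_sqr.
  rewrite (expnS 2 k.*2) -(muln2 k) (expnM 2 k 2) (expnMn (2 ^ k)).
  move: ((2 ^ k) ^ 2) => T le.
  by have := leq_mul le (leqnn (k.+1 * P ^ 2)); lia.
have := leq_mul (leqnn (g ^ 2 * I ^ 2)) leD.
have := leq_mul (leqnn (g ^ 2 * I ^ 2 * C ^ 2)) lejb.
by lia.
Qed.

Local Close Scope nat_scope.

Theorem theorem2p1 (R : realType) (i j N : nat)
    (hi : (2 <= i)%N) (hij : (i <= j)%N) (hjN : (2 * j <= N)%N) :
  let g : R := (gcdn 'C(N, i) 'C(N, j))%:R in
  (N%:R - i%:R + 2) * (N%:R - i%:R + 1) / (i%:R * (i%:R - 1))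
    * (2 ^+ (2 * i - 3)%N * (i%:R - 1) / N%:R ^+ 3) `^ (1 / 2) <= g
  /\ N%:R `^ (1 / 2) * 2 `^ (i%:R - 7 / 2)
       / (i%:R * (i%:R - 1) `^ (1 / 2)) <= g.
Proof.
case: i hi hij => [//|[//|k]] _ hij g.
have := sqr_gcdn_bin_geq _ _ _ hij hjN.
rewrite -(ler_nat R) !(natrM, natrX) -/g !natrB; [|lia..].
have -> : (2 * k.+2 - 3 = k.*2.+1)%N by lia.
have g_ge0 : 0 <= g by exact: ler0n.
have k_ge0 : 0 <= k%:R :> R by exact: ler0n.
have kN : 2 * (k%:R + 2) <= N%:R :> R.
  by rewrite -natrD -natrM ler_nat; lia.
rewrite -!(natr1 k.+1) -!(natr1 k).
move: g_ge0 k_ge0 kN; move: g => g; set x := k%:R; set n := N%:R => g0 x0 xn H.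
have x1 : x + 1 + 1 - 1 = x + 1 by ring.
rewrite !x1.
have T0 : 0 < 2 ^+ k.*2.+1 :> R by rewrite exprn_gt0.
have sq12 (y : R) : 0 <= y -> (y `^ (1 / 2)) ^+ 2 = y.
  by move=> y0; rewrite div1r powR12_sqrt // sqr_sqrtr.
(* The doubled exponent [2 * i - 7] may be negative, so it is split as [(2 * i - 3) - 4]. *)
have T2 : (2 `^ (x + 1 + 1 - 7 / 2)) ^+ 2 = 2 ^+ k.*2.+1 / 2 ^+ 4 :> R.
  rewrite -powR_mulrn ?powR_ge0 // -powRrM.
  rewrite (_ : _ * 2 = k.*2.+1%:R - 4%:R); last first.
    by rewrite -(natr1 k.*2) -(muln2 k) natrM /x; lra.
  rewrite powRD; last by apply/implyP => _; rewrite pnatr_eq0.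
  by rewrite powRN !powR_mulrn.
have n0 : 0 < n by lra.
have H' : 2 ^+ k.*2.+1 * (x + 1) * ((n - x) * (n - (x + 1))) ^+ 2
   / (n ^+ 3 * ((x + 1 + 1) * (x + 1)) ^+ 2) <= g ^+ 2.
  rewrite ler_pdivrMr; first by rewrite (mulrC (n ^+ 3)) (mulrA (g ^+ 2)).
  by rewrite mulr_gt0 ?exprn_gt0 ?mulr_gt0 //; lra.
split; rewrite -(ler_pXn2r (ltn0Sn 1)) ?nnegrE //.
- rewrite exprMn sq12; last by rewrite divr_ge0 ?mulr_ge0 ?exprn_ge0 //; lra.
  apply: le_trans H'; rewrite le_eqVlt; apply/orP; left; apply/eqP.
  by field; rewrite !lt0r_neq0 //; lra.
- apply: mulr_ge0; last exact: powR_ge0.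
  by rewrite divr_ge0 ?mulr_ge0 //; lra.
- rewrite expr_div_n !exprMn !sq12 ?T2; [|lra..].
  apply: le_trans H'.
  (* The second bound is weaker than the first because [n - x] and [n - (x + 1)] are both at least
     [n / 2]. *)
  have P4 : n ^+ 4 <= 2 ^+ 4 * ((n - x) * (n - (x + 1))) ^+ 2.
    have P2 : n ^+ 2 <= 4 * ((n - x) * (n - (x + 1))) by nra.
    have := ler_pM (sqr_ge0 n) (sqr_ge0 n) P2 P2.
    by rewrite -exprD; congr (_ <= _); ring.
  set S := (_ * _) ^+ 2 in P4 *.
  have -> : n * (2 ^+ k.*2.+1 / 2 ^+ 4) / ((x + 1 + 1) ^+ 2 * (x + 1)) =
    2 ^+ k.*2.+1 * (x + 1) / (n ^+ 3 * ((x + 1 + 1) * (x + 1)) ^+ 2) * (n ^+ 4 / 2 ^+ 4).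
    by field; rewrite !lt0r_neq0 //; lra.
  rewrite [leRHS]mulrAC ler_wpM2l //.
  + by rewrite divr_ge0 ?mulr_ge0 ?exprn_ge0 ?mulr_ge0 //; lra.
  + by rewrite ler_pdivrMr ?exprn_gt0 // mulrC.
- by rewrite divr_ge0 ?mulr_ge0 ?powR_ge0 //; lra.
Qed.
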